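(* Let $n,N\in\mathbb{N}$, let $(x_i,\dot x_i,u_i)\in\mathbb{R}^n\times\mathbb{R}^n\times\mathbb{R}$, $i\in[N]$, be given data, and let $\alpha,\beta,\gamma>0$. Let $\mathcal{H}$ be a reproducing kernel Hilbert space of functions $H:\mathbb{R}^n\to\mathbb{R}$ with twice continuously differentiable reproducing kernel $\mathfrak{h}:\mathbb{R}^n\times\mathbb{R}^n\to\mathbb{R}$, and let $\mathcal{G}$ be a reproducing kernel Hilbert space of maps $G:\mathbb{R}^n\to\mathbb{R}^n$ with reproducing kernel $\mathfrak{g}:\mathbb{R}^n\times\mathbb{R}^n\to\mathbb{R}^{n\times n}$. Let $\mathcal{W}$ be a separable real Hilbert space, $\phi:\mathbb{R}^n\to\mathscr{B}(\mathbb{R}^n,\mathcal{W})$ a map, and $\mathfrak{f}(x,y)=\phi(x)^*\phi(y)\in\mathbb{R}^{n\times n}$. Consider the problem $$\min\ \sum_{i=1}^{N}\|\dot x_i+F(x_i)\,\partial H(x_i)-G(x_i)u_i\|^2+\alpha\|Q\|_{\mathscr{H}}^2+\beta\|H\|_{\mathcal{H}}^2+\gamma\|G\|_{\mathcal{G}}^2$$ subject to $(Q,H,G)\in\mathscr{H}(\mathcal{W})_+\times\mathcal{H}\times\mathcal{G}$ and $F=\phi(\cdot)^*Q\phi(\cdot)$. This problem admits a minimizer $(Q,H,G)$ of the form $$Q=\sum_{i,j=1}^{N}\phi(x_i)M_{ij}\phi(x_j)^*,\qquad H=\sum_{i=1}^{N}\partial^{\mathrm{s}}\mathfrak{h}(\cdot,x_i)^\top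 c_i,\qquad G=\sum_{i=1}^{N}\mathfrak{g}(\cdot,x_i)v_i,$$ with $M_{ij}\in\mathbb{R}^{n\times n}$, $c_i\in\mathbb{R}^n$, $v_i\in\mathbb{R}^n$, $i,j\in[N]$, where the block matrix $M=(M_{ij})_{i,j\in[N]}\in\mathbb{R}^{nN\times nN}$ is nonnegative. Furthermore, the map $$F=\sum_{i,j=1}^{N}\mathfrak{f}(\cdot,x_i)M_{ij}\,\mathfrak{f}(\cdot,x_j)^\top$$ is such that $F=\phi(\cdot)^*Q\phi(\cdot)$.
   Context: $[N]=\{1,\dots,N\}$. $\mathscr{B}(\mathcal{V},\mathcal{W})$ is the space of bounded linear operators from $\mathcal{V}$ to $\mathcal{W}$, $\mathscr{B}(\mathcal{W})=\mathscr{B}(\mathcal{W},\mathcal{W})$, and $^*$ denotes the adjoint. An operator $Q\in\mathscr{B}(\mathcal{W})$ (in particular a real square matrix) is called nonnegative if $\langle Qw,w\rangle\ge 0$ for all $w\in\mathcal{W}$; it is not required to be self-adjoint (symmetric). $\mathscr{H}(\mathcal{W})$ is the set of Hilbert-Schmidt operators on $\mathcal{W}$, with norm $\|Q\|_{\mathscr{H}}^2=\sum_i\|Qw_i\|^2$ for an orthonormal basis $(w_i)$ of $\mathcal{W}$, and $\mathscr{H}(\mathcal{W})_+$ is its subset of nonnegative operators. A Hilbert space $\mathcal{G}$ of maps $G:\mathbb{R}^n\to\mathbb{R}^p$ is a reproducing kernel Hilbert space with reproducing kernel $\mathfrak{g}:\mathbb{R}^n\times\mathbb{R}^n\to\mathbb{R}^{p\times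 p}$ if $\mathfrak{g}(\cdot,x)v\in\mathcal{G}$ and $\langle G(x),v\rangle_{\mathbb{R}^p}=\langle G,\mathfrak{g}(\cdot,x)v\rangle_{\mathcal{G}}$ for all $x\in\mathbb{R}^n$, $v\in\mathbb{R}^p$, $G\in\mathcal{G}$. $\partial H:\mathbb{R}^n\to\mathbb{R}^n$ is the gradient of $H$ (elements of $\mathcal{H}$ are differentiable since $\mathfrak{h}$ is twice continuously differentiable), and $\partial^{\mathrm{s}}\mathfrak{h}:\mathbb{R}^n\times\mathbb{R}^n\to\mathbb{R}^n$ is the gradient of $\mathfrak{h}$ with respect to its second variable. *)

(* Defs.v *)
(* Vectors of R^n are columns, of type 'cV[R]_n. *)
From HB Require Import structures.
From mathcomp Require Import all_boot all_order all_algebra.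
From mathcomp Require Import all_classical all_reals all_analysis.

Set Implicit Arguments.
Unset Strict Implicit.
Unset Printing Implicit Defensive.

Import Order.TTheory GRing.Theory Num.Theory.
Import numFieldNormedType.Exports.

Local Open Scope classical_set_scope.
Local Open Scope ring_scope.

HB.mixin Record CompleteNormedModule_isHilbert (R : realType) V
    of CompleteNormedModule R V := {
  hdot : {dot V for (@idfun R)} ;
  hdot_norm : forall v : V, hdot v v = `|v| ^+ 2
}.

#[short(type="hilbertType")]
HB.structure Definition Hilbert (R : realType) :=
  { V of CompleteNormedModule R V & CompleteNormedModule_isHilbert R V }.

Section HilbertTheory.
Context {R : realType} {V : hilbertType R}.
Implicit Types u v w : V.

Lemma hdotC u v : hdot u v = hdot v u.
Proof. by rewrite (hermC (@hdot R V)) expr0 mul1r. Qed.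

Lemma hdotDl u v w : hdot (u + v) w = hdot u w + hdot v w.
Proof. exact: linearDl. Qed.

Lemma hdotZl a u w : hdot (a *: u) w = a * hdot u w.
Proof. exact: linearZl_LR. Qed.

End HilbertTheory.

Section Euclidean.
Context {R : realType}.

(* The norm that the library puts on 'cV[R]_n is the sup norm; the Euclidean
   structure is given by edot. *)
Definition edot n (u v : 'cV[R]_n) : R := \sum_(i < n) u i 0 * v i 0.

Definition nonneg_mx n (A : 'M[R]_n) : Prop :=
  forall w : 'cV[R]_n, 0 <= edot (A *m w) w.

Definition op_mx m n (L : 'cV[R]_n -> 'cV[R]_m) : 'M[R]_(m, n) :=
  \matrix_(i, j) L (delta_mx j 0) i 0.

Definition grad n (f : 'cV[R]_n -> R) (x : 'cV[R]_n) : 'cV[R]_n :=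
  \col_i 'D_(delta_mx i 0) f x.

Definition grad2 n (k : 'cV[R]_n -> 'cV[R]_n -> R) (y x : 'cV[R]_n) :
  'cV[R]_n := grad (k y) x.

(* Meant for a finite-dimensional V, where it says that all partial
   derivatives up to order m exist and are continuous. *)
Fixpoint Cn (m : nat) (V : normedModType R) (f : V -> R) : Prop :=
  if m is m'.+1 then
    (forall x, differentiable f x) /\ (forall v : V, Cn m' ('D_v f))
  else continuous f.

End Euclidean.

Section Operators.
Context {R : realType}.

Definition bounded_linear (V W : normedModType R) (A : V -> W) : Prop :=
  linear A /\ exists C : R, forall v, `|A v| <= C * `|v|.

Definition separable (T : topologicalType) : Prop :=
  exists2 D : set T, countable D & dense D.

(* The adjoint of A : R^n -> W, i-th coordinate <A e_i, w>; see adjointP. *)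
Definition adjoint n (W : hilbertType R) (A : 'cV[R]_n -> W) (w : W) :
  'cV[R]_n := \col_i hdot (A (delta_mx i 0)) w.

Lemma adjointP n (W : hilbertType R) (A : 'cV[R]_n -> W) :
  linear A -> forall v w, hdot (A v) w = edot v (adjoint A w).
Proof.
move=> lA v w.
have A0 : A 0 = 0.
  by have := lA (-1) 0 0; rewrite scaler0 addr0 scaleN1r addNr.
have AZ a u : A (a *: u) = a *: A u by rewrite -[a *: u]addr0 lA A0 addr0.
have AD u u' : A (u + u') = A u + A u' by rewrite -[u in LHS]scale1r lA scale1r.
have vE : v = \sum_i v i 0 *: delta_mx i 0.
  by rewrite {1}(matrix_sum_delta v); apply: eq_bigr => i _; rewrite big_ord1.
have h0 : hdot (0 : W) w = 0 by rewrite -(scale0r (0 : W)) hdotZl mul0r.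
rewrite {1}vE (big_morph A AD A0).
rewrite (big_morph (fun z => hdot z w) (fun a b => hdotDl a b w) h0).
by apply: eq_bigr => i _; rewrite AZ hdotZl mxE.
Qed.

Definition nonneg_op (W : hilbertType R) (Q : W -> W) : Prop :=
  forall w, 0 <= hdot (Q w) w.

Definition lin_span (W : lmodType R) (B : set W) : set W :=
  [set w | exists (s : seq W) (a : W -> R),
     (forall b, b \in s -> B b) /\ w = \sum_(b <- s) a b *: b].

Definition orthonormal_basis (W : hilbertType R) (B : set W) : Prop :=
  (forall b c, B b -> B c -> hdot b c = (b == c)%:R) /\ dense (lin_span B).

Definition gram_schmidt_step (W : hilbertType R) (L : seq W) (v : W) : seq W :=
  let r := v - \sum_(b <- L) hdot v b *: b in
  if r == 0 then L else `|r|^-1 *: r :: L.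

Lemma gram_schmidt_stepP (W : hilbertType R) (L : seq W) (v : W) :
  uniq L -> {in L &, forall b c, hdot b c = (b == c)%:R} ->
  let L' := gram_schmidt_step L v in
  [/\ uniq L', {in L' &, forall b c, hdot b c = (b == c)%:R} &
      lin_span [set` L'] v].
Proof.
move=> uL oL; rewrite /gram_schmidt_step.
set p := \sum_(b <- L) _; set r := v - p.
have vE : v = r + p by rewrite subrK.
have h0 c : hdot (0 : W) c = 0 by rewrite -(scale0r (0 : W)) hdotZl mul0r.
have hp c : c \in L -> hdot p c = hdot v c.
  move=> cL; rewrite (big_morph (fun z => hdot z c) (fun a b => hdotDl a b c) (h0 c)).
  rewrite (bigD1_seq c)//= hdotZl (oL c c)// eqxx mulr1 big_seq_cond big1 ?addr0//.
  by move=> b /andP[bL bc]; rewrite hdotZl (oL b c)// (negPf bc) mulr0.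
have hr c : c \in L -> hdot r c = 0.
  by move=> cL; apply: (@addIr _ (hdot p c)); rewrite -hdotDl -vE add0r hp.
case: eqP => [r0|/eqP r0] /=.
  split => //; exists L, (hdot v); split => //.
  by rewrite {1}vE r0 add0r.
set b0 := _ *: r.
have nr0 : `|r| != 0 by rewrite normr_eq0.
have hb0 c : c \in L -> hdot b0 c = 0 by move=> cL; rewrite hdotZl hr// mulr0.
have hb00 : hdot b0 b0 = 1.
  by rewrite hdot_norm normrZ normfV normr_id mulVf// expr1n.
have b0L : b0 \notin L.
  by apply/negP => /hb0; rewrite hb00 => /eqP; rewrite oner_eq0.
have neq c : c \in L -> (b0 == c) = false.
  by move=> cL; apply/negP => /eqP b0c; move: b0L; rewrite b0c cL.
split; first by rewrite b0L.
  move=> b c; rewrite !inE => /predU1P[->|bL] /predU1P[->|cL].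
  - by rewrite eqxx.
  - by rewrite hb0// neq.
  - by rewrite hdotC hb0// eq_sym neq.
  - exact: oL.
exists (b0 :: L), (fun b => if b == b0 then `|r| else hdot v b); split => //.
rewrite big_cons eqxx scalerA mulfV// scale1r {1}vE; congr (_ + _).
by apply: eq_big_seq => b bL; rewrite eq_sym neq.
Qed.

Lemma orthonormal_basis_exists (W : hilbertType R) :
  separable W -> exists B : set W, orthonormal_basis B.
Proof.
move=> [D cD dD].
have [e eD] : exists e : nat -> W, D `<=` range e.
  have /pfcard_geP[D0|[f]] := cD.
    by exists (fun=> 0) => w; rewrite D0.
  by exists f => w Dw; have [k _ <-] := @surj _ _ _ _ f w Dw; exists k.
pose L := fix L k := if k is k'.+1 then gram_schmidt_step (L k') (e k') else [::].
have LP k : uniq (L k) /\ {in L k &, forall b c, hdot b c = (b == c)%:R}.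
  elim: k => //= k [uL oL].
  by have [] := gram_schmidt_stepP (e k) uL oL.
have Lsub k : {subset L k <= L k.+1}.
  move=> b bL /=; rewrite /gram_schmidt_step; case: ifP => // _.
  by rewrite inE bL orbT.
have Lmono i j : (i <= j)%N -> {subset L i <= L j}.
  move=> /subnK <-; elim: (j - i)%N => //= d IHd b /IHd.
  exact: (Lsub (d + i)%N).
exists [set b | exists k, b \in L k]; split.
  move=> b c [i bi] [j cj]; apply: (LP (maxn i j)).2.
    exact: (Lmono _ _ (leq_maxl _ _)).
  exact: (Lmono _ _ (leq_maxr _ _)).
move=> O O0 oO; have [w [Ow Dw]] := dD O O0 oO; exists w; split => //.
have [k _ ekw] := eD _ Dw; have [uL oL] := LP k.
have [_ _] := gram_schmidt_stepP (e k) uL oL; rewrite ekw => -[s [a [sL ->]]].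
by exists s, a; split => // b /sL bL; exists k.+1; rewrite /= ekw.
Qed.

(* ||Q||_HS^2 in \bar R, computed in some fixed orthonormal basis, which
   exists as soon as W is separable (orthonormal_basis_exists). *)
Definition hs_sqnorm (W : hilbertType R) (Q : W -> W) : \bar R :=
  \esum_(b in xget set0 (@orthonormal_basis W)) (`|Q b| ^+ 2)%:E.

Definition hilbert_schmidt (W : hilbertType R) (Q : W -> W) : Prop :=
  bounded_linear Q /\ (hs_sqnorm Q < +oo)%E.

Definition hilbert_schmidt_nonneg (W : hilbertType R) (Q : W -> W) : Prop :=
  hilbert_schmidt Q /\ nonneg_op Q.

(* The elements of V are identified with maps R^n -> R^p through the injective
   linear map ev. *)
Definition is_rkhs n p (V : hilbertType R) (ev : V -> 'cV[R]_n -> 'cV[R]_p)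
    (k : 'cV[R]_n -> 'cV[R]_n -> 'M[R]_p) : Prop :=
  [/\ linear ev,
      injective ev &
      forall (x : 'cV[R]_n) (v : 'cV[R]_p),
        exists2 kxv : V, ev kxv = (fun y => k y x *m v)
          & forall G : V, edot (ev G x) v = hdot G kxv].

(* The case p = 1, with R identified with 'cV[R]_1 and 'M[R]_1. *)
Definition is_scalar_rkhs n (V : hilbertType R) (ev : V -> 'cV[R]_n -> R)
    (k : 'cV[R]_n -> 'cV[R]_n -> R) : Prop :=
  is_rkhs (fun (H : V) x => (ev H x)%:M : 'cV[R]_1) (fun x y => (k x y)%:M).

End Operators.

Section Problem.
Context {R : realType} (n N : nat).
Variables (W HH GG : hilbertType R).
Variables (x xdot : 'I_N -> 'cV[R]_n) (u : 'I_N -> R) (alpha beta gamma : R).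
Variables (evH : HH -> 'cV[R]_n -> R) (evG : GG -> 'cV[R]_n -> 'cV[R]_n).
Variable phi : 'cV[R]_n -> 'cV[R]_n -> W.

(* The matrix of phi(y)^* Q phi(y). *)
Definition compress (Q : W -> W) (y : 'cV[R]_n) : 'M[R]_n :=
  op_mx (fun v => adjoint (phi y) (Q (phi y v))).

(* The matrix of phi(y)^* phi(z). *)
Definition feature_kernel (y z : 'cV[R]_n) : 'M[R]_n :=
  op_mx (fun v => adjoint (phi y) (phi z v)).

Definition objective (F : 'cV[R]_n -> 'M[R]_n) (Q : W -> W) (H : HH) (G : GG)
  : R :=
  \sum_(i < N)
     (let r := xdot i + F (x i) *m grad (evH H) (x i)
               - u i *: evG G (x i) in
      edot r r)
  + alpha * fine (hs_sqnorm Q) + beta * `|H| ^+ 2 + gamma * `|G| ^+ 2.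

Definition minimizer (Q : W -> W) (H : HH) (G : GG) : Prop :=
  hilbert_schmidt_nonneg Q /\
  forall (Q' : W -> W) (H' : HH) (G' : GG), hilbert_schmidt_nonneg Q' ->
    objective (compress Q) Q H G <= objective (compress Q') Q' H' G'.

End Problem.

(* Main.v *)
Require Import Defs.
From mathcomp Require Import all_boot all_order all_algebra.
From mathcomp Require Import all_classical all_reals all_analysis.
From mathcomp Require Import ring lra.

Set Implicit Arguments.
Unset Strict Implicit.
Unset Printing Implicit Defensive.

Import Order.TTheory GRing.Theory Num.Theory.
Import numFieldNormedType.Exports.

Local Open Scope classical_set_scope.
Local Open Scope ring_scope.

(** The data term sees Q only through the numbers <phi(x_i) e, Q phi(x_i) f>
    with e and f in the canonical basis of R^n, and sees H and G only through
    the partial derivatives of H and the values of G at the x_i.  The latter are inner products with fixed elements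
    of the two kernel spaces: a value of G is represented by a section of g,
    and a partial derivative of H by the corresponding derivative of the map
    y |-> h(., y), which exists in norm because h is C^2
    (derivable_feature_map).  Hence only three finite-dimensional spans matter,
    those of the phi(x_i) e, of the representers of the derivatives of H and of
    the representers of the values of G.

    Projecting onto them leaves the data term unchanged, keeps Q nonnegative
    (Q becomes P Q P) and does not increase the penalties.  For H and G this is
    Bessel's inequality.  For Q, whose Hilbert-Schmidt norm is computed in an
    unrelated orthonormal basis of W, the reason is that the squared matrix
    coefficients of Q on any finite orthonormal family add up to at most its
    squared Hilbert-Schmidt norm (sqr_matrix_coefficients_le), with the reverse
    inequality for operators that live on the span (hs_matrix_op_le).

    In coordinates on orthonormal families of these spans
    (orthonormalization), the problem becomes the minimization of a polynomial
    that dominates a multiple of the squared Euclidean norm, over the closed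
    set of triples whose matrix is nonnegative.  The polynomial need not be
    convex, because Q multiplies the gradient of H, so existence comes from compactness
    (coercive_min, reduced_minimizer).  The objective of the triple rebuilt
    from a minimizer is at most the reduced minimum
    (objective_matrix_op_le), which is at most the objective of any admissible
    triple (reduced_objective_le).

    Finally the orthonormal families are combinations of the original vectors,
    b_k = sum_(i,e) A_i(k,e) phi(x_i) e.  An operator of matrix q in the family
    b is therefore the sum of the phi(x_i) M_ij phi(x_j)^T with
    M_ij = A_i^T q A_j, where phi(x_j)^T is the adjoint.  As a block matrix M
    is C^T q C for the block row C of the A_i, so it is nonnegative when q
    is. *)

(** * Inner products and orthonormal families *)

Section InnerProduct.
Context {R : realType} {V : hilbertType R}.
Implicit Types u v w : V.

Lemma hdotDr u v w : hdot w (u + v) = hdot w u + hdot w v.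
Proof. by rewrite hdotC hdotDl !(hdotC w). Qed.

Lemma hdotZr a u w : hdot w (a *: u) = a * hdot w u.
Proof. by rewrite hdotC hdotZl (hdotC w). Qed.

Lemma hdot0l w : hdot (0 : V) w = 0.
Proof. by rewrite -(scale0r (0 : V)) hdotZl mul0r. Qed.

Lemma hdot0r w : hdot w (0 : V) = 0.
Proof. by rewrite hdotC hdot0l. Qed.

Lemma hdotNl u w : hdot (- u) w = - hdot u w.
Proof. by rewrite -scaleN1r hdotZl mulN1r. Qed.

Lemma hdotNr u w : hdot w (- u) = - hdot w u.
Proof. by rewrite hdotC hdotNl (hdotC w). Qed.

Lemma hdotBl u v w : hdot (u - v) w = hdot u w - hdot v w.
Proof. by rewrite hdotDl hdotNl. Qed.

Lemma hdotBr u v w : hdot w (u - v) = hdot w u - hdot w v.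
Proof. by rewrite hdotDr hdotNr. Qed.

Lemma hdot_suml I (r : seq I) (P : pred I) (F : I -> V) w :
  hdot (\sum_(i <- r | P i) F i) w = \sum_(i <- r | P i) hdot (F i) w.
Proof.
exact: (big_morph (fun z => hdot z w) (fun a b => hdotDl a b w) (hdot0l w)).
Qed.

Lemma hdot_sumr I (r : seq I) (P : pred I) (F : I -> V) w :
  hdot w (\sum_(i <- r | P i) F i) = \sum_(i <- r | P i) hdot w (F i).
Proof.
exact: (big_morph (fun z => hdot w z) (fun a b => hdotDr a b w) (hdot0r w)).
Qed.

Lemma hdot_ge0 v : 0 <= hdot v v.
Proof. by rewrite hdot_norm sqr_ge0. Qed.

Lemma CauchySchwarz_hdot u v : hdot u v ^+ 2 <= hdot u u * hdot v v.
Proof.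
have [->|v0] := eqVneq v 0; first by rewrite !hdot0r mulr0 expr0n.
have vv0 : 0 < hdot v v by rewrite hdot_norm exprn_gt0// normr_gt0.
(* Up to a factor, this is the component of u orthogonal to v. *)
have := hdot_ge0 (hdot v v *: u - hdot u v *: v).
rewrite hdotBl !hdotBr !hdotZl !hdotZr (hdotC v u) => p.
have {p} : 0 <= hdot v v * (hdot u u * hdot v v - hdot u v ^+ 2) by lra.
by rewrite pmulr_rge0// subr_ge0.
Qed.

Lemma norm_hdot_le u v : `|hdot u v| <= `|u| * `|v|.
Proof.
rewrite -(@ler_pXn2r _ 2)// ?nnegrE ?mulr_ge0// exprMn -!hdot_norm.
by rewrite real_normK ?num_real//; exact: CauchySchwarz_hdot.
Qed.

Lemma cvg_hdotr {T : Type} (F : set_system T) {FF : Filter F} (f : T -> V) l w :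
  f @ F --> l -> (fun t => hdot w (f t)) @ F --> hdot w l.
Proof.
move=> /cvgrPdist_le fl; apply/cvgrPdist_le => e e0.
have c0 : 0 < `|w| + 1 by rewrite ltr_wpDl.
have ec0 : 0 < e / (`|w| + 1) by rewrite divr_gt0.
near=> t; rewrite -hdotBr; apply: (le_trans (norm_hdot_le _ _)).
apply: (@le_trans _ _ ((`|w| + 1) * `|l - f t|)).
  by rewrite ler_wpM2r// lerDl.
rewrite mulrC -ler_pdivlMr//; near: t; exact: fl.
Unshelve. all: by end_near. Qed.

End InnerProduct.

Definition orthonormal_family (R : realType) (V : hilbertType R) (r : nat)
  (b : 'I_r -> V) : Prop := forall k l, hdot (b k) (b l) = (k == l)%:R.

Section Orthonormal.
Context {R : realType} {V : hilbertType R}.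

Lemma sum_delta r (k : 'I_r) (f : 'I_r -> R) : \sum_l f l * (l == k)%:R = f k.
Proof.
rewrite (bigD1 k)//= eqxx mulr1 big1 ?addr0// => l /negPf ->.
by rewrite mulr0.
Qed.

Section Family.
Context {r : nat} {b : 'I_r -> V} (ob : orthonormal_family b).

Lemma hdot_combo (a : 'I_r -> R) l : hdot (\sum_k a k *: b k) (b l) = a l.
Proof.
rewrite hdot_suml -[RHS](sum_delta l).
by apply: eq_bigr => k _; rewrite hdotZl ob.
Qed.

Lemma norm_combo (a : 'I_r -> R) : `|\sum_k a k *: b k| ^+ 2 = \sum_k a k ^+ 2.
Proof.
rewrite -hdot_norm hdot_sumr; apply: eq_bigr => k _.
by rewrite hdotZr hdot_combo expr2.
Qed.

Lemma bessel v : \sum_k hdot v (b k) ^+ 2 <= `|v| ^+ 2.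
Proof.
set p := \sum_k hdot v (b k) *: b k.
have vp : hdot v p = \sum_k hdot v (b k) ^+ 2.
  by rewrite hdot_sumr; apply: eq_bigr => k _; rewrite hdotZr expr2.
have := hdot_ge0 (v - p); rewrite hdotBl !hdotBr (hdotC p v) vp.
rewrite (hdot_norm p) norm_combo hdot_norm; lra.
Qed.

End Family.

(** Gram-Schmidt, by induction on the list of treated indices.  The matrix of
    coefficients records that the orthonormal family stays inside the span of
    the given one: it turns coordinates in b into coefficients on the data. *)
Lemma orthonormalization (I : finType) (e : I -> V) :
  exists (r : nat) (b : 'I_r -> V) (A : 'I_r -> I -> R),
    [/\ orthonormal_family b,
        forall k, b k = \sum_i A k i *: e i &
        forall i, e i = \sum_k hdot (e i) (b k) *: b k].
Proof.
suff: forall s : seq I, exists (r : nat) (b : 'I_r -> V) (A : 'I_r -> I -> R),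
    [/\ orthonormal_family b,
        forall k, b k = \sum_i A k i *: e i &
        forall i, i \in s -> e i = \sum_k hdot (e i) (b k) *: b k].
  move=> /(_ (enum I))[r [b [A [ob bA eb]]]]; exists r, b, A; split => // i.
  by apply: eb; rewrite mem_enum.
elim=> [|i0 s [r [b [A [ob bA eb]]]]].
  by exists 0%N, (fun=> 0), (fun _ _ => 0); split => // -[].
set p := \sum_k hdot (e i0) (b k) *: b k.
have [ep|ep] := eqVneq (e i0) p.
  by exists r, b, A; split => // i /predU1P[->|/eb].
set q := e i0 - p.
have nq : `|q| != 0 by rewrite normr_eq0 subr_eq0.
have qb l : hdot q (b l) = 0 by rewrite hdotBl hdot_combo// subrr.
pose b' (k : 'I_r.+1) := if unlift ord0 k is Some k' then b k' else `|q|^-1 *: q.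
pose A' (k : 'I_r.+1) (i : I) := if unlift ord0 k is Some k' then A k' i else
  `|q|^-1 * ((i == i0)%:R - \sum_k hdot (e i0) (b k) * A k i).
have b'0 : b' ord0 = `|q|^-1 *: q by rewrite /b' unlift_none.
have b'S k : b' (lift ord0 k) = b k by rewrite /b' liftK.
have bb0 : hdot (b' ord0) (b' ord0) = 1.
  by rewrite b'0 hdot_norm normrZ normfV normr_id mulVf// expr1n.
exists r.+1, b', A'; split.
- move=> k l; case: (unliftP ord0 k) => [k'|] ->; case: (unliftP ord0 l) => [l'|] ->.
  + by rewrite !b'S ob (inj_eq lift_inj).
  + by rewrite b'S b'0 hdotZr hdotC qb mulr0.
  + by rewrite b'S b'0 hdotZl qb mulr0.
  + by rewrite bb0 eqxx.
- move=> k; rewrite /b' /A'; case: unliftP => [k' _|_]; first exact: bA.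
  under eq_bigr do rewrite -scalerA; rewrite -scaler_sumr; congr (_ *: _).
  under eq_bigr do rewrite scalerBl; rewrite sumrB; congr (_ - _).
    rewrite (bigD1 i0)//= eqxx scale1r big1 ?addr0// => i /negPf ->.
    by rewrite scale0r.
  under [RHS]eq_bigr do rewrite scaler_suml.
  rewrite exchange_big; apply: eq_bigr => k1 _; rewrite [X in _ *: X]bA scaler_sumr.
  by apply: eq_bigr => i _; rewrite scalerA.
- move=> i; rewrite big_ord_recl b'0.
  under [in X in _ -> _ = X]eq_bigr do rewrite b'S.
  move=> /predU1P[->|/eb ei].
    have -> : hdot (e i0) (`|q|^-1 *: q) = `|q|.
      have -> : e i0 = q + p by rewrite subrK.
      rewrite hdotDl hdotZr hdot_norm expr2 mulKf// hdotZr (hdotC p).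
      rewrite hdot_sumr big1 ?mulr0 ?addr0// => k _.
      by rewrite hdotZr qb mulr0.
    by rewrite scalerA mulfV// scale1r subrK.
  suff -> : hdot (e i) (`|q|^-1 *: q) = 0 by rewrite scale0r add0r.
  rewrite hdotC hdotZl ei hdot_sumr big1 ?mulr0// => k _.
  by rewrite hdotZr qb mulr0.
Qed.

End Orthonormal.

(** * Bounded linear maps *)

Lemma bounded_linear_continuous (R : realType) (V W : normedModType R)
  (A : V -> W) : bounded_linear A -> continuous A.
Proof.
move=> [lA [C AC]] w; apply/cvgrPdist_le => e e0.
have c0 : 0 < `|C| + 1 by rewrite ltr_wpDl.
have ec0 : 0 < e / (`|C| + 1) by rewrite divr_gt0.
near=> t.
have -> : A w - A t = A (w - t) by rewrite addrC -scaleN1r -lA scaleN1r addrC.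
apply: (le_trans (AC _)); apply: (@le_trans _ _ ((`|C| + 1) * `|w - t|)).
  by rewrite ler_wpM2r// (le_trans (ler_norm _))// lerDl.
by rewrite mulrC -ler_pdivlMr//; near: t; exact: cvgr_dist_le.
Unshelve. all: by end_near. Qed.

Lemma bounded_linear_hdot (R : realType) (V W : hilbertType R) (A : V -> W) v :
  bounded_linear A -> bounded_linear (fun w => hdot (A w) v : R).
Proof.
move=> [lA [C AC]]; split.
  by move=> a w w'; rewrite lA hdotDl hdotZl.
exists (C * `|v|) => w; apply: (le_trans (norm_hdot_le _ _)).
by rewrite mulrAC ler_wpM2r.
Qed.

Section LinearMaps.
Context {R : realType} {V W : normedModType R} {A : V -> W}.
Hypothesis lA : linear A.

Lemma linear_fun0 : A 0 = 0.
Proof. by have := lA (-1) 0 0; rewrite scaler0 addr0 scaleN1r addNr. Qed.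

Lemma linear_funZ a v : A (a *: v) = a *: A v.
Proof. by rewrite -[a *: v]addr0 lA linear_fun0 addr0. Qed.

Lemma linear_funD v w : A (v + w) = A v + A w.
Proof. by rewrite -[v in LHS]scale1r lA scale1r. Qed.

Lemma linear_fun_sum I (r : seq I) (P : pred I) (F : I -> V) :
  A (\sum_(i <- r | P i) F i) = \sum_(i <- r | P i) A (F i).
Proof. exact: (big_morph A linear_funD linear_fun0). Qed.

End LinearMaps.

(** * Hilbert-Schmidt norms and finite orthonormal families *)

Section OrthonormalBasis.
Context {R : realType} {W : hilbertType R} (B : set W).
Hypothesis oB : orthonormal_basis B.
Implicit Types (s : seq W) (v w : W).

Lemma esum_le_seq (F : W -> R) (S : R) :
  (forall s, uniq s -> (forall b, b \in s -> B b) -> \sum_(b <- s) F b <= S) ->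
  (\esum_(b in B) (F b)%:E <= S%:E)%E.
Proof.
move=> FS; apply: ge_ereal_sup => _ [X [finX XB] <-].
rewrite fsbig_finite//= sumEFin lee_fin; apply: FS => [|b].
  exact: finmap.fset_uniq.
by rewrite in_fset_set// inE => /XB.
Qed.

Lemma seq_le_esum (F : W -> R) s : uniq s -> (forall b, b \in s -> B b) ->
  ((\sum_(b <- s) F b)%:E <= \esum_(b in B) (F b)%:E)%E.
Proof.
move=> us sB; apply: esum_ge; exists [set` s].
  by split; [exact: finite_seq | move=> b /sB].
by rewrite -fsbig_seq// sumEFin.
Qed.

Section Subfamily.
Variable s : seq W.
Hypotheses (us : uniq s) (sB : forall b, b \in s -> B b).

Lemma orthonormal_nth : orthonormal_family (fun k : 'I_(size s) => s`_k).
Proof.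
move=> k l; rewrite oB.1 ?nth_uniq//; exact/sB/mem_nth.
Qed.

Lemma bessel_seq v : \sum_(b <- s) hdot v b ^+ 2 <= `|v| ^+ 2.
Proof. by rewrite (big_nth 0) big_mkord; exact: bessel orthonormal_nth v. Qed.

Lemma orthonormal_span w : lin_span [set` s] w ->
  w = \sum_(b <- s) hdot w b *: b.
Proof.
move=> [t [a [ts ->]]].
under [RHS]eq_bigr do rewrite hdot_suml scaler_suml.
rewrite [RHS]exchange_big/= !big_seq; apply: eq_bigr => c /ts cs.
rewrite (bigD1_seq c)//= hdotZl oB.1 ?eqxx ?mulr1; try exact: sB.
rewrite big_seq_cond big1 ?addr0// => b /andP[bs /negPf bc].
by rewrite hdotZl oB.1 1?eq_sym ?bc ?mulr0 ?scale0r//; exact: sB.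
Qed.

End Subfamily.

(** On the span of a finite part s of B, f is the inner product with the vector
    of coordinates f(b), so that Cauchy-Schwarz gives the bound there.  The
    vectors that violate it form an open set, which would meet the dense span
    of B if it were not empty. *)
Lemma sqr_functional_le (f : W -> R) (S : R) : bounded_linear f ->
  (\esum_(b in B) (f b ^+ 2)%:E <= S%:E)%E ->
  forall w, f w ^+ 2 <= S * `|w| ^+ 2.
Proof.
move=> bf fS w; rewrite leNgt; apply/negP => fw.
pose O := [set w' : W | S * `|w'| ^+ 2 < f w' ^+ 2].
have oO : open O.
  have -> : O = (fun w' => f w' ^+ 2 - S * `|w'| ^+ 2) @^-1` [set z | 0 < z].
    by apply/seteqP; split => w' /=; rewrite subr_gt0.
  apply: open_comp => [w' _|]; last exact: open_gt.
  have cf := @bounded_linear_continuous _ _ _ _ bf w'.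
  apply: cvgB; first by rewrite [X in X @ _ --> _](_ : _ = fun z => f z * f z);
     [apply: cvgM; exact: cf | apply/funext => z; rewrite expr2].
  apply: cvgM; first exact: cvg_cst.
  rewrite [X in X @ _ --> _](_ : _ = fun z : W => `|z| * `|z|);
     [|by apply/funext => z; rewrite expr2].
  by rewrite expr2; apply: cvgM; exact: norm_continuous.
have [w1 [Ow1 [s [a [sB w1E]]]]] := oB.2 O (ex_intro _ w fw) oO.
move: Ow1; rewrite /O /= ltNge => /negP; apply.
(* The combination w1 may list a basis vector several times. *)
have us := undup_uniq s.
have sB' b : b \in undup s -> B b by rewrite mem_undup; exact: sB.
have w1s : w1 = \sum_(b <- undup s) hdot w1 b *: b.
  apply: orthonormal_span => //; exists s, a; split => // b /=.
  by rewrite mem_undup.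
set p := \sum_(b <- undup s) f b *: b.
have pp : hdot p p = \sum_(b <- undup s) f b ^+ 2.
  rewrite {2}/p hdot_sumr !big_seq; apply: eq_bigr => c cs.
  rewrite hdotZr expr2; congr (_ * _); rewrite hdot_suml (bigD1_seq c)//=.
  rewrite hdotZl oB.1 ?eqxx ?mulr1; try exact: sB'.
  rewrite big_seq_cond big1 ?addr0// => b /andP[bs /negPf bc].
  by rewrite hdotZl oB.1 ?bc ?mulr0 ?scale0r//; exact: sB'.
have -> : f w1 = hdot w1 p.
  rewrite {1}w1s (linear_fun_sum bf.1) hdot_sumr; apply: eq_bigr => b _.
  by rewrite (linear_funZ bf.1) hdotZr mulrC.
apply: (le_trans (CauchySchwarz_hdot _ _)).
rewrite mulrC (hdot_norm w1) ler_wpM2r ?sqr_ge0// pp -lee_fin.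
by apply: le_trans fS; exact: (seq_le_esum (fun b => f b ^+ 2)).
Qed.

(** With T the left-hand sum and S the right-hand one, the vector
    sum_l f(b_l) b_l has squared norm T and f takes the value T on it; hence
    T^2 <= S T. *)
Lemma sum_sqr_functional_le r (b : 'I_r -> W) (f : W -> R) :
  orthonormal_family b -> bounded_linear f ->
  ((\sum_l f (b l) ^+ 2)%:E <= \esum_(w in B) (f w ^+ 2)%:E)%E.
Proof.
move=> ob bf.
have /(@esum_ge0 R _ B) : forall w, B w -> (0 <= (f w ^+ 2)%:E)%E.
  by move=> w _; rewrite lee_fin sqr_ge0.
case E : (esum _ _) => [S| |] // S0; last by rewrite leey.
rewrite lee_fin in S0 *; set T := \sum_l _.
have T0 : 0 <= T by rewrite sumr_ge0// => l _; rewrite sqr_ge0.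
have [->//|Tn0] := eqVneq T 0.
have Tp : 0 < T by rewrite lt_neqAle eq_sym Tn0.
have := @sqr_functional_le f S bf _ (\sum_l f (b l) *: b l).
rewrite E lexx norm_combo// (linear_fun_sum bf.1) -/T => /(_ isT).
under eq_bigr do rewrite (linear_funZ bf.1) -[_ *: _]/(_ * _) -expr2.
by rewrite -/T expr2 ler_pM2r.
Qed.

End OrthonormalBasis.

Section HilbertSchmidt.
Context {R : realType} {W : hilbertType R}.
Hypothesis sW : separable W.
Variables (r : nat) (b : 'I_r -> W).
Hypothesis ob : orthonormal_family b.

Let B : set W := xget set0 (@orthonormal_basis R W).

Let oB : orthonormal_basis B.
Proof. by exact: xgetPex (orthonormal_basis_exists sW). Qed.

(** For fixed k, w |-> <Q w, b_k> is a bounded functional, whose squares on the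
    family b are controlled by its squares on the basis B; these add up over k
    to at most |Q w|^2, by Bessel's inequality. *)
Lemma sqr_matrix_coefficients_le (Q : W -> W) : bounded_linear Q ->
  ((\sum_k \sum_l hdot (Q (b l)) (b k) ^+ 2)%:E <= hs_sqnorm Q)%E.
Proof.
move=> bQ.
have: (\esum_(w in B) \sum_k ((hdot (Q w) (b k)) ^+ 2)%:E <= hs_sqnorm Q)%E.
  by apply: le_esum => w Bw; rewrite sumEFin lee_fin; exact: bessel.
apply: le_trans; rewrite -sumEFin esum_sum;
  last by move=> i j Bi _; rewrite lee_fin sqr_ge0.
apply: lee_sum => k _.
exact: (sum_sqr_functional_le oB ob (bounded_linear_hdot (b k) bQ)).
Qed.

(** The operator of matrix q in the family b, which vanishes on the orthogonal
    complement of b. *)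
Definition matrix_op (q : 'M[R]_r) (w : W) : W :=
  \sum_k (\sum_l q k l * hdot (b l) w) *: b k.

Lemma hdot_matrix_op q w w' : hdot (matrix_op q w) w' =
  \sum_k \sum_l q k l * hdot (b l) w * hdot (b k) w'.
Proof.
rewrite hdot_suml; apply: eq_bigr => k _.
by rewrite hdotZl mulr_suml.
Qed.

Lemma norm_matrix_op q w :
  `|matrix_op q w| ^+ 2 = \sum_k hdot (\sum_l q k l *: b l) w ^+ 2.
Proof.
rewrite norm_combo//; apply: eq_bigr => k _; congr (_ ^+ 2).
by rewrite hdot_suml; apply: eq_bigr => l _; rewrite hdotZl.
Qed.

Lemma linear_matrix_op q : linear (matrix_op q).
Proof.
move=> a w w'; rewrite /matrix_op scaler_sumr -big_split; apply: eq_bigr => k _.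
rewrite /= scalerA -scalerDl; congr (_ *: _); rewrite mulr_sumr -big_split.
by apply: eq_bigr => l _ /=; rewrite hdotDr hdotZr; ring.
Qed.

Lemma bounded_linear_matrix_op q : bounded_linear (matrix_op q).
Proof.
split; first exact: linear_matrix_op.
pose S := \sum_k `|\sum_l q k l *: b l| ^+ 2.
have S0 : 0 <= S by rewrite sumr_ge0// => k _; rewrite sqr_ge0.
exists (Num.sqrt S) => w.
rewrite -(@ler_pXn2r _ 2)// ?nnegrE ?mulr_ge0 ?sqrtr_ge0//.
rewrite exprMn sqr_sqrtr// norm_matrix_op mulr_suml; apply: ler_sum => k _.
by rewrite -!hdot_norm CauchySchwarz_hdot.
Qed.

(** |Q w|^2 is the sum over k of <r_k, w>^2, with r_k = sum_l q_kl b_l the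
    k-th row of q; by Bessel's inequality the sum of <r_k, w>^2 over the basis
    is at most |r_k|^2. *)
Lemma hs_matrix_op_le q :
  (hs_sqnorm (matrix_op q) <= (\sum_k \sum_l q k l ^+ 2)%:E)%E.
Proof.
apply: esum_le_seq => s us sB.
under eq_bigr do rewrite norm_matrix_op.
rewrite exchange_big; apply: ler_sum => k _.
by rewrite -(norm_combo ob); exact: (bessel_seq oB).
Qed.

Lemma hilbert_schmidt_matrix_op q : hilbert_schmidt (matrix_op q).
Proof.
split; first exact: bounded_linear_matrix_op.
exact: (le_lt_trans (hs_matrix_op_le q) (ltry _)).
Qed.

End HilbertSchmidt.

(** * Differentiability of kernel sections *)

Section SecondDifference.
Context {R : realType} {V : normedModType R}.
Implicit Types (f : V -> R) (z v w : V).

Lemma is_derive_segment f z v (a : R) : differentiable f (z + a *: v) ->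
  is_derive a 1 (fun t => f (z + t *: v)) ('D_v f (z + a *: v)).
Proof.
move=> df.
have E : (fun t : R => t^-1 *: (((fun t => f (z + t *: v)) \o shift a) (t *: 1) -
      f (z + a *: v))) =
    (fun t : R => t^-1 *: ((f \o shift (z + a *: v)) (t *: v) - f (z + a *: v))).
  apply/funext => t /=; congr (_ *: (f _ - _)).
  by rewrite [t *: 1]mulr1 scalerDl addrCA.
apply: DeriveDef; last by rewrite /derive E.
by rewrite /derivable E; exact: diff_derivable.
Qed.

Lemma derive_scale f z v (a : R) : differentiable f z ->
  'D_(a *: v) f z = a * 'D_v f z.
Proof. by move=> df; rewrite !deriveE// linearZ. Qed.

Lemma mean_value_segment f z v : (forall y, differentiable f y) ->
  exists2 a : R, a \in `]0, 1[ & f (z + v) - f z = 'D_v f (z + a *: v).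
Proof.
move=> df; have dphi a := is_derive_segment (df (z + a *: v)).
have cphi : {within `[0, 1 : R], continuous (fun t => f (z + t *: v))}.
  apply: continuous_subspaceT => a; apply/differentiable_continuous/derivable1_diffP.
  exact: (@ex_derive _ _ _ _ _ _ _ (dphi a)).
have [a aI E] := MVT (@ltr01 R) (fun a _ => dphi a) cphi.
by exists a => //; rewrite -[RHS]mulr1 -[in RHS](subr0 1) -E scale1r scale0r addr0.
Qed.

(** The left-hand side is an increment along s v of the difference
    y |-> f(y + t w) - f(y).  A first use of the mean value theorem turns it
    into an increment along t w of the derivative of f, and a second one turns
    that into the mixed derivative. *)
Lemma second_difference f z v w (s t : R) :
  (forall y, differentiable f y) -> (forall y, differentiable ('D_v f) y) ->
  exists a b : R, [/\ `|a| <= `|s|, `|b| <= `|t| &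
    f (z + s *: v + t *: w) - f (z + s *: v) - f (z + t *: w) + f z =
    s * t * 'D_w ('D_v f) (z + a *: v + b *: w)].
Proof.
move=> df ddf.
pose g y := f (y + t *: w) - f y.
have dft y : is_derive y (s *: v) (fun y => f (y + t *: w)) ('D_(s *: v) f (y + t *: w)).
  have E : (fun k : R => k^-1 *: (((fun y => f (y + t *: w)) \o shift y)
        (k *: (s *: v))
      - f (y + t *: w))) =
    (fun k : R => k^-1 *: ((f \o shift (y + t *: w)) (k *: (s *: v)) - f (y + t *: w))).
    by apply/funext => k /=; rewrite addrA.
  apply: DeriveDef; last by rewrite /derive E.
  by rewrite /derivable E; exact: diff_derivable.
have dg y : differentiable g y.
  apply: differentiableB => //; apply: differentiable_comp => //.
have [a aI gE] := mean_value_segment z (s *: v) dg.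
have [b bI hE] := mean_value_segment (z + a *: (s *: v)) (t *: w) ddf.
have le1 (c d : R) : c \in `]0, 1[ -> `|c * d| <= `|d|.
  rewrite in_itv /= => /andP[c0 c1].
  by rewrite normrM ler_piMl// ger0_norm ltW.
exists (a * s), (b * t); split; try exact: le1.
transitivity (g (z + s *: v) - g z); first by rewrite /g; ring.
rewrite gE deriveB//; last exact: diff_derivable.
rewrite (@derive_val _ _ _ _ _ _ _ (dft _)) !derive_scale// -mulrBr hE derive_scale//.
by rewrite !scalerA mulrA.
Qed.

Lemma second_difference_cvg f z v w :
  (forall y, differentiable f y) -> (forall y, differentiable ('D_v f) y) ->
  {for z, continuous ('D_w ('D_v f))} ->
  forall e : R, 0 < e -> exists2 d : R, 0 < d & forall s t : R, s != 0 -> t != 0 ->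
    `|s| < d -> `|t| < d ->
    `|(s * t)^-1 * (f (z + s *: v + t *: w) - f (z + s *: v) - f (z + t *: w) + f z)
       - 'D_w ('D_v f) z| < e.
Proof.
move=> df ddf cf e e0.
have /cvgrPdist_lt/(_ e e0)/nbhs_ballP[r r0 rP] := cf.
have c0 : 0 < `|v| + `|w| + 1 by rewrite ltr_wpDl// addr_ge0.
exists (r / (`|v| + `|w| + 1)); first by rewrite divr_gt0.
move=> s t s0 t0 sd td.
have [a [b [as_ bt ->]]] := second_difference z w s t df ddf.
rewrite mulKf ?mulf_neq0// distrC; apply: rP.
rewrite -ball_normE /= opprD addrA opprD addrA subrr add0r -opprD normrN.
apply: (le_lt_trans (ler_normD _ _)); rewrite !normrZ.
apply: (@le_lt_trans _ _ (`|s| * `|v| + `|t| * `|w|)).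
  by rewrite lerD// ler_wpM2r.
apply: (@le_lt_trans _ _ (r / (`|v| + `|w| + 1) * (`|v| + `|w|))).
  by rewrite mulrDr lerD// ler_wpM2r// ltW.
by rewrite mulrAC ltr_pdivrMr// ltr_pM2l// ltrDl.
Qed.

End SecondDifference.

(** The Gram kernel of K being C^2 makes the difference quotients of K Cauchy:
    their inner products are second difference quotients of the kernel, which tend
    to its mixed second derivative on the diagonal. *)
Lemma derivable_feature_map (R : realType) (V : normedModType R)
    (HH : hilbertType R) (K : V -> HH) :
  Cn 2 (fun z : V * V => hdot (K z.1) (K z.2)) ->
  forall x v, derivable K x v.
Proof.
move=> [df C1] x v.
set f := (fun z : V * V => hdot (K z.1) (K z.2)).
have [ddf C0] := C1 (v, 0).
pose q (t : R) : HH := t^-1 *: (K (t *: v + x) - K x).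
have qq s t : hdot (q s) (q t) = (s * t)^-1 *
    (f ((x, x) + s *: (v, 0) + t *: (0, v)) - f ((x, x) + s *: (v, 0))
     - f ((x, x) + t *: (0, v)) + f (x, x)).
  rewrite /q /f /= !scaler0 !addr0 invfM hdotZl hdotZr hdotBl !hdotBr.
  rewrite ![x + _]addrC; ring.
suff : cauchy (q @ 0^') by move/cauchy_cvg.
apply: cauchy_exP => e e0.
have e'0 : 0 < e ^+ 2 / 4 by rewrite divr_gt0// exprn_gt0.
have [d d0 dP] := second_difference_cvg df ddf (C0 (0, v) (x, x)) e'0.
(* Every quotient q t with 0 < |t| < d is close to the single one q (d / 2):
   the three inner products in |q (d / 2) - q t|^2 are within e^2 / 4 of the
   same limit, and enter with weights 1, -2 and 1. *)
have s0 : 0 < d / 2 by rewrite divr_gt0.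
have sn0 : d / 2 != 0 by rewrite gt_eqF.
have sd : `|d / 2| < d by rewrite gtr0_norm//; lra.
exists (q (d / 2)).
have : \forall t \near (0 : R)^', t != 0 /\ `|t| < d.
  by apply: filterI; [exact: (@nbhs_dnbhs_neq R 0) | exact: (@dnbhs0_lt R R)].
apply: filterS => t [t0 td]; rewrite /= -ball_normE /=.
rewrite -(@ltr_pXn2r _ 2)// ?nnegrE ?(ltW e0)// -hdot_norm hdotBl !hdotBr.
rewrite (hdotC (q t) (q (d / 2))).
have := dP _ _ sn0 sn0 sd sd; have := dP _ _ sn0 t0 sd td.
have := dP _ _ t0 t0 td td; rewrite -!qq !ltr_norml.
by move=> /andP[? ?] /andP[? ?] /andP[? ?]; lra.
Qed.

(** Together with the reproducing property, this makes the derivative of a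
    kernel section represent the derivative of the elements of the space. *)
Lemma derive_hdot (R : realType) (V : normedModType R) (HH : hilbertType R)
    (K : V -> HH) x v H : derivable K x v ->
  'D_v (fun y => hdot H (K y)) x = hdot H ('D_v K x).
Proof.
move=> dK; apply: cvg_lim => //.
have -> : (fun t : R => t^-1 *: (((fun y => hdot H (K y)) \o shift x) (t *: v)
      - hdot H (K x))) =
    (fun t => hdot H (t^-1 *: ((K \o shift x) (t *: v) - K x))).
  by apply/funext => t; rewrite hdotZr hdotBr.
exact: cvg_hdotr.
Qed.

(** * Existence of a minimizer in coordinates *)

Section CoerciveMinimum.
Import ArrowAsProduct.

(** Direct method of the calculus of variations in finite dimension:
    coercivity confines the search to a cube, compact by Tychonoff. *)
Lemma coercive_min (R : realType) (I : finType) (S : set (I -> R))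
    (J : (I -> R) -> R) (d : R) :
  0 < d -> closed S -> S !=set0 -> continuous J ->
  (forall p, d * \sum_i p i ^+ 2 <= J p) ->
  exists2 p, S p & forall p', S p' -> J p <= J p'.
Proof.
move=> d0 cS [p0 Sp0] cJ dJ.
have J0 : 0 <= J p0.
  apply: le_trans (dJ p0); apply: mulr_ge0; first exact: ltW.
  by apply: sumr_ge0 => i _; exact: sqr_ge0.
pose C := J p0 / d + 1.
have C1 : 1 <= C by rewrite lerDr divr_ge0// ltW.
pose A := [set p : I -> R | forall i, p i \in `[- C, C]].
have cA : compact (S `&` A).
  rewrite setIC; apply: compact_closedI => //.
  have := @tychonoff I (fun=> R) (fun=> [set` `[- C, C]]) (fun=> @segment_compact _ _ _).
  by [].
have small p : J p <= J p0 -> A p.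
  move=> Jp i; rewrite in_itv /= -ler_norml.
  rewrite -(@ler_pXn2r _ 2)// ?nnegrE ?(le_trans ler01)//.
  have pi : p i ^+ 2 <= J p0 / d.
    rewrite ler_pdivlMr// mulrC; apply: le_trans Jp; apply: le_trans (dJ p).
    rewrite ler_pM2l// (bigD1 i)//= lerDl sumr_ge0// => j _.
    by rewrite sqr_ge0.
  rewrite real_normK ?num_real//; apply: (le_trans pi).
  apply: (@le_trans _ _ C); first by rewrite lerDl.
  by rewrite expr2 ler_peMl// (le_trans ler01).
have ne : S `&` A !=set0 by exists p0; split => //; exact: small.
have [p /[!inE]-[Sp Ap] pmin] := compact_EVT_min ne cA (continuous_subspaceT cJ).
exists p => // p' Sp'; have [p'p0|p0p'] := leP (J p') (J p0).
  by apply: pmin; rewrite inE; split => //; exact: small.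
apply: le_trans (ltW p0p'); apply: pmin; rewrite inE; split => //.
exact: small.
Qed.

End CoerciveMinimum.

Lemma sum_continuous (R : realType) (X : topologicalType) (I : Type)
    (s : seq I) (F : I -> X -> R) :
  (forall i, continuous (F i)) -> continuous (fun p => \sum_(i <- s) F i p).
Proof.
by move=> cF; apply: continuous_big => //; exact: add_continuous.
Qed.

Lemma sqr_continuous (R : realType) (X : topologicalType) (f : X -> R) :
  continuous f -> continuous (fun p => f p ^+ 2).
Proof.
move=> cf p; apply: (@continuous_comp _ _ _ f (fun y : R => y ^+ 2) p (cf p)).
exact: exprn_continuous.
Qed.

Section PointwiseContinuity.
Context {R : realType} {X : topologicalType}.
Implicit Types f g : X -> R.

Lemma add_fun_continuous f g : continuous f -> continuous g ->
  continuous (fun p => f p + g p).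
Proof. by move=> cf cg p; apply: cvgD; [exact: cf | exact: cg]. Qed.

Lemma sub_fun_continuous f g : continuous f -> continuous g ->
  continuous (fun p => f p - g p).
Proof. by move=> cf cg p; apply: cvgB; [exact: cf | exact: cg]. Qed.

Lemma mulr_cst_continuous f (k : R) : continuous f ->
  continuous (fun p => f p * k).
Proof. by move=> cf p; apply: cvgM; [exact: cf | exact: cvg_cst]. Qed.

Lemma mull_cst_continuous f (k : R) : continuous f ->
  continuous (fun p => k * f p).
Proof. by move=> cf p; apply: cvgM; [exact: cvg_cst | exact: cf]. Qed.

Lemma mul_fun_continuous f g : continuous f -> continuous g ->
  continuous (fun p => f p * g p).
Proof. by move=> cf cg p; apply: cvgM; [exact: cf | exact: cg]. Qed.

End PointwiseContinuity.

(** The problem in coordinates: q, a and c are the coordinates of Q, H and G in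
    orthonormal families, and wf, hf and gf are those of the vectors that
    represent the data. *)
Section ReducedProblem.
Context {R : realType} (n N r s t : nat).
Variables (xdot : 'I_N -> 'cV[R]_n) (u : 'I_N -> R) (alpha beta gamma : R).
Variables (wf : 'I_N -> 'I_n -> 'I_r -> R) (hf : 'I_N -> 'I_n -> 'I_s -> R)
  (gf : 'I_N -> 'I_n -> 'I_t -> R).

Definition reduced_residual (q : 'I_r -> 'I_r -> R) (a : 'I_s -> R)
    (c : 'I_t -> R) (i : 'I_N) (e : 'I_n) : R :=
  xdot i e 0
  + \sum_f (\sum_k \sum_l q k l * wf i f l * wf i e k) * (\sum_k a k * hf i f k)
  - u i * (\sum_k c k * gf i e k).

Definition reduced_objective (q : 'I_r -> 'I_r -> R) (a : 'I_s -> R)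
    (c : 'I_t -> R) : R :=
  \sum_i \sum_e reduced_residual q a c i e ^+ 2
  + alpha * (\sum_k \sum_l q k l ^+ 2) + beta * (\sum_k a k ^+ 2)
  + gamma * (\sum_k c k ^+ 2).

Lemma reduced_residual_continuous (X : topologicalType)
    (q : X -> 'I_r -> 'I_r -> R) (a : X -> 'I_s -> R) (c : X -> 'I_t -> R) :
  (forall k l, continuous (fun p => q p k l)) ->
  (forall k, continuous (a ^~ k)) -> (forall k, continuous (c ^~ k)) ->
  forall i e, continuous (fun p => reduced_residual (q p) (a p) (c p) i e).
Proof.
move=> cq ca cc i e; apply: sub_fun_continuous.
  apply: add_fun_continuous; first by move=> p; exact: cvg_cst.
  apply: sum_continuous => f; apply: mul_fun_continuous.
    apply: sum_continuous => k; apply: sum_continuous => l.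
    by do 2!apply: mulr_cst_continuous; exact: cq.
  by apply: sum_continuous => k; apply: mulr_cst_continuous; exact: ca.
apply: mull_cst_continuous; apply: sum_continuous => k.
by apply: mulr_cst_continuous; exact: cc.
Qed.

Lemma quadratic_form_continuous (X : topologicalType) (w : 'cV[R]_r)
    (q : X -> 'I_r -> 'I_r -> R) : (forall k l, continuous (fun p => q p k l)) ->
  continuous (fun p => \sum_k (\sum_l q p k l * w l 0) * w k 0).
Proof.
move=> cq; apply: sum_continuous => k; apply: mulr_cst_continuous.
by apply: sum_continuous => l; apply: mulr_cst_continuous; exact: cq.
Qed.

Lemma reduced_objective_continuous (X : topologicalType)
    (q : X -> 'I_r -> 'I_r -> R) (a : X -> 'I_s -> R) (c : X -> 'I_t -> R) :
  (forall k l, continuous (fun p => q p k l)) ->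
  (forall k, continuous (a ^~ k)) -> (forall k, continuous (c ^~ k)) ->
  continuous (fun p => reduced_objective (q p) (a p) (c p)).
Proof.
move=> cq ca cc; do 3?apply: add_fun_continuous.
- apply: sum_continuous => i; apply: sum_continuous => e.
  by apply: sqr_continuous; exact: reduced_residual_continuous.
- apply: mull_cst_continuous; apply: sum_continuous => k.
  by apply: sum_continuous => l; exact: sqr_continuous.
- by apply: mull_cst_continuous; apply: sum_continuous => k; exact: sqr_continuous.
- by apply: mull_cst_continuous; apply: sum_continuous => k; exact: sqr_continuous.
Qed.

Import ArrowAsProduct.

(** The data term is in general not convex in (q, a) jointly, as q multiplies a,
    whence the use of compactness.  Coercivity comes from the penalties alone. *)
Lemma reduced_minimizer : 0 < alpha -> 0 < beta -> 0 < gamma ->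
  exists (q : 'M[R]_r) (a : 'I_s -> R) (c : 'I_t -> R), nonneg_mx q /\
    forall (q' : 'M[R]_r) (a' : 'I_s -> R) (c' : 'I_t -> R), nonneg_mx q' ->
      reduced_objective q a c <= reduced_objective q' a' c'.
Proof.
move=> al be ga.
pose I := ('I_r * 'I_r + ('I_s + 'I_t))%type.
pose qp (p : I -> R) k l := p (inl (k, l)).
pose ap (p : I -> R) k := p (inr (inl k)).
pose cp (p : I -> R) k := p (inr (inr k)).
pose J p := reduced_objective (qp p) (ap p) (cp p).
pose mq p : 'M[R]_r := \matrix_(k, l) qp p k l.
pose S := [set p : I -> R | nonneg_mx (mq p)].
have cproj (i : I) : continuous (fun p : I -> R => p i).
  exact: (@proj_continuous I (fun=> R) i).
have cJ : continuous J.
  by apply: reduced_objective_continuous => *; exact: cproj.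
have cS : closed S.
  have -> : S = \bigcap_(w in [set: 'cV[R]_r])
      ((fun p => \sum_k (\sum_l qp p k l * w l 0) * w k 0) @^-1` [set z | 0 <= z]).
    have E p (w : 'cV[R]_r) : \sum_k (\sum_l qp p k l * w l 0) * w k 0 =
        edot (mq p *m w) w.
      apply: eq_bigr => k _; rewrite mxE; congr (_ * _).
      by apply: eq_bigr => l _; rewrite mxE.
    by apply/seteqP; split => p Sp w => [_|]; have := Sp w; rewrite /= E //; exact.
  apply: closed_bigI => w _; apply: closed_comp; last exact: closed_ge.
  move=> p _; move: p; apply: (@quadratic_form_continuous _ w qp) => k l.
  exact: cproj.
pose d := Num.min alpha (Num.min beta gamma).
have d0 : 0 < d by rewrite /d !lt_min al be ga.
have S0 : S (fun=> 0).
  move=> w; apply: sumr_ge0 => k _; rewrite mxE big1 ?mul0r// => l _.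
  by rewrite mxE mul0r.
have dJ p : d * \sum_i p i ^+ 2 <= J p.
  rewrite !big_sumType /= !mulrDr addrA /J /reduced_objective.
  have le_d (k : R) (K : finType) (F : K -> R) : d <= k ->
      d * (\sum_i F i ^+ 2) <= k * (\sum_i F i ^+ 2).
    by move=> dk; rewrite ler_wpM2r// sumr_ge0// => ? _; rewrite sqr_ge0.
  have res0 : 0 <= \sum_i \sum_e reduced_residual (qp p) (ap p) (cp p) i e ^+ 2.
    by do 2! apply: sumr_ge0 => ? _; exact: sqr_ge0.
  apply: lerD; [apply: lerD|].
  - rewrite -[leLHS]add0r; apply: lerD => //.
    rewrite pair_bigA /=; under [in leRHS]eq_bigr do rewrite /qp -surjective_pairing.
    by apply: le_d; rewrite /d ge_min lexx.
  - by apply: le_d; rewrite /d !ge_min lexx orbT.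
  - by apply: le_d; rewrite /d !ge_min lexx !orbT.
have [p Sp pmin] := coercive_min d0 cS (ex_intro _ _ S0) cJ dJ.
exists (mq p), (ap p), (cp p); split => // q' a' c' q'0.
pose p' (i : I) := match i with
  | inl kl => q' kl.1 kl.2 | inr (inl k) => a' k | inr (inr k) => c' k end.
have qE (q : 'M[R]_r) p0 : (forall k l, p0 (inl (k, l)) = q k l) -> mq p0 = q.
  by move=> E; apply/matrixP => k l; rewrite mxE; exact: E.
have := pmin p'; rewrite /S /= (qE q')// => /(_ q'0).
suff -> : mq p = qp p :> ('I_r -> 'I_r -> R) by [].
by apply/funext => k; apply/funext => l; rewrite mxE.
Qed.

End ReducedProblem.

(** * Representers in reproducing kernel spaces *)

Lemma edot_delta (R : realType) n (v : 'cV[R]_n) e : edot v (delta_mx e 0) = v e 0.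
Proof.
rewrite /edot (bigD1 e)//= mxE !eqxx mulr1 big1 ?addr0// => f /negPf fe.
by rewrite mxE fe mulr0.
Qed.

Lemma rkhs_representers (R : realType) n p (V : hilbertType R)
    (ev : V -> 'cV[R]_n -> 'cV[R]_p) k : is_rkhs ev k ->
  exists K : 'cV[R]_n -> 'I_p -> V,
    (forall G x e, ev G x e 0 = hdot G (K x e)) /\
    (forall x e y, ev (K x e) y = k y x *m delta_mx e 0).
Proof.
move=> [_ _ rep].
have ex (xe : 'cV[R]_n * 'I_p) : exists kxe : V,
    (forall G, ev G xe.1 xe.2 0 = hdot G kxe) /\
    (forall y, ev kxe y = k y xe.1 *m delta_mx xe.2 0).
  have [kxv kE kP] := rep xe.1 (delta_mx xe.2 0).
  by exists kxv; split => [G|y]; rewrite ?kE// -kP edot_delta.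
have [K KP] := choice ex.
exists (fun x e => K (x, e)); split => [G x e|x e y].
  exact: (KP (x, e)).1.
exact: (KP (x, e)).2.
Qed.

Lemma scalar_rkhs_representers (R : realType) n (V : hilbertType R)
    (ev : V -> 'cV[R]_n -> R) k : is_scalar_rkhs ev k ->
  exists K : 'cV[R]_n -> V,
    (forall H x, ev H x = hdot H (K x)) /\
    (forall x y, hdot (K x) (K y) = k x y).
Proof.
move=> /rkhs_representers[K [KP KE]].
have evK H x : ev H x = hdot H (K x 0).
  by rewrite -KP mxE mulr1n.
exists (fun x => K x 0); split => // x y.
rewrite hdotC -evK; have /matrixP/(_ 0 0) := KE y 0 x.
by rewrite !mxE big_ord1 !mxE !mulr1n mulr1.
Qed.

(** * Operators and functionals on the span of an orthonormal family *)

Section Coordinates.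
Context {R : realType} {V : hilbertType R} {r : nat} {b : 'I_r -> V}.

Lemma hdot_coord v H : v = \sum_k hdot v (b k) *: b k ->
  hdot H v = \sum_k hdot H (b k) * hdot v (b k).
Proof.
by move=> {1}->; rewrite hdot_sumr; apply: eq_bigr => k _; rewrite hdotZr mulrC.
Qed.

(** Q enters only through its coefficients on b: replacing Q by its compression
    to the span of b does not change its values against vectors of the span. *)
Lemma hdot_op_coord (Q : V -> V) v w : linear Q ->
  v = \sum_k hdot v (b k) *: b k -> w = \sum_k hdot w (b k) *: b k ->
  hdot v (Q w) =
    \sum_k \sum_l hdot (Q (b l)) (b k) * hdot w (b l) * hdot v (b k).
Proof.
move=> lQ vE wE; rewrite hdotC (hdot_coord _ vE); apply: eq_bigr => k _.
rewrite {1}wE (linear_fun_sum lQ) hdot_suml mulr_suml; apply: eq_bigr => l _.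
by rewrite (linear_funZ lQ) hdotZl; ring.
Qed.

End Coordinates.

Section MatrixOp.
Context {R : realType} {W : hilbertType R} {r : nat} {b : 'I_r -> W}.

(** The quadratic form of the matrix at z is the one of Q at sum_k z_k b_k. *)
Lemma nonneg_compression (Q : W -> W) : linear Q -> nonneg_op Q ->
  nonneg_mx (\matrix_(k, l) hdot (Q (b l)) (b k)).
Proof.
move=> lQ Q0 z.
have := Q0 (\sum_k z k 0 *: b k).
rewrite (linear_fun_sum lQ) hdot_sumr; congr (_ <= _); apply: eq_bigr => k _.
rewrite hdotZr mulrC mxE hdot_suml; congr (_ * _); apply: eq_bigr => l _.
by rewrite mxE (linear_funZ lQ) hdotZl mulrC.
Qed.

Lemma nonneg_matrix_op (q : 'M[R]_r) : nonneg_mx q -> nonneg_op (matrix_op b q).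
Proof.
move=> q0 w; have := q0 (\col_k hdot (b k) w).
rewrite hdot_matrix_op; congr (_ <= _); apply: eq_bigr => k _.
rewrite !mxE mulr_suml; apply: eq_bigr => l _.
by rewrite mxE.
Qed.

Lemma matrix_op_coord (q : 'M[R]_r) k l : orthonormal_family b ->
  hdot (matrix_op b q (b l)) (b k) = q k l.
Proof.
move=> ob; rewrite hdot_combo//; under eq_bigr do rewrite ob.
by rewrite sum_delta.
Qed.

End MatrixOp.

Lemma nonneg_mx_congr (R : realType) m n (q : 'M[R]_m) (C : 'M[R]_(m, n)) :
  nonneg_mx q -> nonneg_mx (C^T *m q *m C).
Proof.
move=> q0 z; have E (k : nat) (y y' : 'cV[R]_k) : edot y y' = (y^T *m y') 0 0.
  by rewrite mxE; apply: eq_bigr => i _; rewrite mxE.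
have := q0 (C *m z); rewrite !E !trmx_mul trmxK.
by rewrite !mulmxA.
Qed.

Lemma linear_delta (R : realType) n (W : normedModType R) (A : 'cV[R]_n -> W) v :
  linear A -> A v = \sum_e v e 0 *: A (delta_mx e 0).
Proof.
move=> lA; rewrite {1}(matrix_sum_delta v) (linear_fun_sum lA).
by apply: eq_bigr => e _; rewrite big_ord1 (linear_funZ lA).
Qed.

(** * Operators built from the feature map *)

Section Features.
Context {R : realType} {n N : nat} {W : hilbertType R}.
Variables (x : 'I_N -> 'cV[R]_n) (phi : 'cV[R]_n -> 'cV[R]_n -> W).
Hypothesis lphi : forall y, linear (phi y).

Lemma compressE Q y e f :
  compress phi Q y e f = hdot (phi y (delta_mx e 0)) (Q (phi y (delta_mx f 0))).
Proof. by rewrite !mxE. Qed.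

(** With z the sum over j of A_j phi(x_j)^T w, the expansion of b gives
    z_l = <b_l, w>, so the double sum is the sum over i of
    phi(x_i) (A_i^T q z), that is, the sum of the (q z)_k b_k. *)
Lemma sandwich_matrix_op r (b : 'I_r -> W) (A : 'I_N -> 'M[R]_(r, n)) (q : 'M[R]_r) :
  (forall k, b k = \sum_i \sum_e A i k e *: phi (x i) (delta_mx e 0)) ->
  matrix_op b q = (fun w => \sum_(i < N) \sum_(j < N)
     phi (x i) (((A i)^T *m q *m A j) *m adjoint (phi (x j)) w)).
Proof.
move=> bA; apply/funext => w.
pose z : 'cV[R]_r := \sum_j A j *m adjoint (phi (x j)) w.
have zE l : z l 0 = hdot (b l) w.
  rewrite summxE bA hdot_suml; apply: eq_bigr => j _.
  rewrite mxE hdot_suml; apply: eq_bigr => e _.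
  by rewrite !mxE hdotZl.
transitivity (\sum_i phi (x i) ((A i)^T *m (q *m z))); last first.
  apply: eq_bigr => i _; rewrite -(linear_fun_sum (lphi _)) !mulmx_sumr.
  by congr (phi _ _); apply: eq_bigr => j _; rewrite !mulmxA.
under eq_bigr do rewrite (linear_delta _ (lphi _)).
transitivity (\sum_k (q *m z) k 0 *: b k).
  apply: eq_bigr => k _; congr (_ *: _); rewrite mxE.
  by apply: eq_bigr => l _; rewrite zE.
under [LHS]eq_bigr do rewrite bA scaler_sumr.
rewrite exchange_big; apply: eq_bigr => i _.
under [LHS]eq_bigr do rewrite scaler_sumr.
rewrite exchange_big; apply: eq_bigr => e _.
rewrite mxE scaler_suml; apply: eq_bigr => k _.
by rewrite [_^T _ _]mxE scalerA mulrC.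
Qed.

Lemma compress_sandwich (M : 'I_N -> 'I_N -> 'M[R]_n) :
  (fun y => \sum_(i < N) \sum_(j < N)
     feature_kernel phi y (x i) *m M i j *m (feature_kernel phi y (x j))^T)
  = compress phi (fun w => \sum_(i < N) \sum_(j < N)
     phi (x i) (M i j *m adjoint (phi (x j)) w)).
Proof.
apply/funext => y; apply/matrixP => e f; rewrite compressE.
rewrite summxE hdot_sumr; apply: eq_bigr => i _.
rewrite summxE hdot_sumr; apply: eq_bigr => j _.
have -> : adjoint (phi (x j)) (phi y (delta_mx f 0)) =
    col f (feature_kernel phi y (x j))^T.
  by apply/colP => e'; rewrite !mxE hdotC.
have fkE v : hdot (phi y (delta_mx e 0)) (phi (x i) v) =
    (feature_kernel phi y (x i) *m v) e 0.
  rewrite (linear_delta v (lphi _)) hdot_sumr mxE; apply: eq_bigr => e' _.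
  by rewrite !mxE hdotZr mulrC.
by rewrite fkE colE !mulmxA -colE [RHS]mxE.
Qed.

End Features.

(** * Comparison with the problem in coordinates *)

Section Representer.
Context {R : realType} {n N : nat} {W HH GG : hilbertType R}.
Variables (x xdot : 'I_N -> 'cV[R]_n) (u : 'I_N -> R) (alpha beta gamma : R).
Variables (evH : HH -> 'cV[R]_n -> R) (evG : GG -> 'cV[R]_n -> 'cV[R]_n).
Variable phi : 'cV[R]_n -> 'cV[R]_n -> W.
Variables (D : 'I_N -> 'I_n -> HH) (K : 'I_N -> 'I_n -> GG).
Hypothesis DP : forall H i e, grad (evH H) (x i) e 0 = hdot H (D i e).
Hypothesis KP : forall G i e, evG G (x i) e 0 = hdot G (K i e).
Variables (r s t : nat) (b : 'I_r -> W) (bH : 'I_s -> HH) (bG : 'I_t -> GG).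
Hypothesis bP : forall i e, phi (x i) (delta_mx e 0) =
  \sum_k hdot (phi (x i) (delta_mx e 0)) (b k) *: b k.
Hypothesis bHP : forall i e, D i e = \sum_k hdot (D i e) (bH k) *: bH k.
Hypothesis bGP : forall i e, K i e = \sum_k hdot (K i e) (bG k) *: bG k.

Lemma objectiveE Q H G : linear Q ->
  objective x xdot u alpha beta gamma evH evG (compress phi Q) Q H G =
  \sum_i \sum_e reduced_residual xdot u
      (fun i e k => hdot (phi (x i) (delta_mx e 0)) (b k))
      (fun i e k => hdot (D i e) (bH k)) (fun i e k => hdot (K i e) (bG k))
      (fun k l => hdot (Q (b l)) (b k)) (fun k => hdot H (bH k))
      (fun k => hdot G (bG k)) i e ^+ 2
  + alpha * fine (hs_sqnorm Q) + beta * `|H| ^+ 2 + gamma * `|G| ^+ 2.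
Proof.
move=> lQ; rewrite /objective; do 3! congr (_ + _).
apply: eq_bigr => i _; apply: eq_bigr => e _; rewrite -expr2; congr (_ ^+ 2).
rewrite /reduced_residual !mxE KP -(hdot_coord G (bGP i e)); congr (_ + _ - _).
apply: eq_bigr => f _; rewrite DP -(hdot_coord H (bHP i f)); congr (_ * _).
by rewrite compressE (hdot_op_coord lQ (bP i e) (bP i f)).
Qed.

(** Passing to coordinates projects Q, H and G onto the three spans: the data
    term is the same and no penalty increases. *)
Lemma reduced_objective_le Q H G : separable W ->
  orthonormal_family b -> orthonormal_family bH -> orthonormal_family bG ->
  0 < alpha -> 0 < beta -> 0 < gamma -> hilbert_schmidt Q ->
  reduced_objective xdot u alpha beta gamma
      (fun i e k => hdot (phi (x i) (delta_mx e 0)) (b k))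
      (fun i e k => hdot (D i e) (bH k)) (fun i e k => hdot (K i e) (bG k))
      (fun k l => hdot (Q (b l)) (b k)) (fun k => hdot H (bH k))
      (fun k => hdot G (bG k))
  <= objective x xdot u alpha beta gamma evH evG (compress phi Q) Q H G.
Proof.
move=> sW ob obH obG al be ga [bQ Qfin]; rewrite objectiveE; last exact: bQ.1.
apply: lerD; [apply: lerD; [apply: lerD => //|]|];
  rewrite ler_pM2l//; try exact: bessel.
have Q0 : (0 <= hs_sqnorm Q)%E.
  by apply: esum_ge0 => w _; rewrite lee_fin sqr_ge0.
rewrite -lee_fin fineK ?ge0_fin_numE//.
exact: sqr_matrix_coefficients_le.
Qed.

(** Rebuilding Q, H and G from coordinates.  The inequality comes from the
    Hilbert-Schmidt norm of Q alone; the other terms agree. *)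
Lemma objective_matrix_op_le (q : 'M[R]_r) (a : 'I_s -> R) (c : 'I_t -> R) :
  separable W ->
  orthonormal_family b -> orthonormal_family bH -> orthonormal_family bG ->
  0 < alpha ->
  objective x xdot u alpha beta gamma evH evG (compress phi (matrix_op b q))
    (matrix_op b q) (\sum_k a k *: bH k) (\sum_k c k *: bG k)
  <= reduced_objective xdot u alpha beta gamma
      (fun i e k => hdot (phi (x i) (delta_mx e 0)) (b k))
      (fun i e k => hdot (D i e) (bH k)) (fun i e k => hdot (K i e) (bG k)) q a c.
Proof.
move=> sW ob obH obG al; rewrite objectiveE; last exact: linear_matrix_op.
rewrite !norm_combo// /reduced_objective.
have -> : (fun k l => hdot (matrix_op b q (b l)) (b k)) = q.
  by apply/funext => k; apply/funext => l; rewrite matrix_op_coord.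
have -> : (fun k => hdot (\sum_k a k *: bH k) (bH k)) = a.
  by apply/funext => k; rewrite hdot_combo.
have -> : (fun k => hdot (\sum_k c k *: bG k) (bG k)) = c.
  by apply/funext => k; rewrite hdot_combo.
rewrite !lerD2r lerD2l ler_pM2l//.
have [_ qfin] := hilbert_schmidt_matrix_op sW ob q.
have q0 : (0 <= hs_sqnorm (matrix_op b q))%E.
  by apply: esum_ge0 => w _; rewrite lee_fin sqr_ge0.
rewrite -lee_fin fineK ?ge0_fin_numE//.
exact: hs_matrix_op_le.
Qed.

End Representer.

(** * The representer theorem *)

Theorem theorem1 (R : realType) (n N : nat)
    (x xdot : 'I_N -> 'cV[R]_n) (u : 'I_N -> R)
    (alpha beta gamma : R)
    (halpha : 0 < alpha) (hbeta : 0 < beta) (hgamma : 0 < gamma)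
    (HH : hilbertType R) (evH : HH -> 'cV[R]_n -> R)
    (h : 'cV[R]_n -> 'cV[R]_n -> R)
    (hH : is_scalar_rkhs evH h)
    (hC2 : Cn 2 (fun z : 'cV[R]_n * 'cV[R]_n => h z.1 z.2))
    (GG : hilbertType R) (evG : GG -> 'cV[R]_n -> 'cV[R]_n)
    (g : 'cV[R]_n -> 'cV[R]_n -> 'M[R]_n)
    (hG : is_rkhs evG g)
    (W : hilbertType R) (hW : separable W)
    (phi : 'cV[R]_n -> 'cV[R]_n -> W)
    (hphi : forall y, bounded_linear (phi y)) :
  exists (M : 'I_N -> 'I_N -> 'M[R]_n) (c v : 'I_N -> 'cV[R]_n)
         (Q : W -> W) (H : HH) (G : GG),
    [/\ minimizer x xdot u alpha beta gamma evH evG phi Q H G,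
        Q = (fun w => \sum_(i < N) \sum_(j < N)
                        phi (x i) (M i j *m adjoint (phi (x j)) w)),
        evH H = (fun y => \sum_(i < N) edot (grad2 h y (x i)) (c i)),
        evG G = (fun y => \sum_(i < N) g y (x i) *m v i) &
        nonneg_mx (\mxblock_(i < N, j < N) M i j)
        /\ (fun y => \sum_(i < N) \sum_(j < N)
              feature_kernel phi y (x i) *m M i j
                *m (feature_kernel phi y (x j))^T)
           = compress phi Q].
Proof.
have [KH [evHK KK]] := scalar_rkhs_representers hH.
have [KG [evGK KGE]] := rkhs_representers hG.
have lphi y : linear (phi y) := (hphi y).1.
have dKH y e : derivable KH y e.
  by apply: derivable_feature_map; under eq_fun do rewrite KK.
(* D i e represents the e-th partial derivative at x i, K i e the e-th
   coordinate of the value at x i. *)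
pose D i e : HH := 'D_(delta_mx e 0) KH (x i).
have DP H i e : grad (evH H) (x i) e 0 = hdot H (D i e).
  have -> : evH H = (fun y => hdot H (KH y)) by apply/funext => y.
  by rewrite mxE; apply: derive_hdot; exact: dKH.
pose K i e := KG (x i) e.
have KP G i e : evG G (x i) e 0 = hdot G (K i e) by exact: evGK.
have [r [b [A [ob bA bP]]]] :=
  orthonormalization (fun ie : 'I_N * 'I_n => phi (x ie.1) (delta_mx ie.2 0)).
have [s [bH [AH [obH bHA bHP]]]] :=
  orthonormalization (fun ie : 'I_N * 'I_n => D ie.1 ie.2).
have [t [bG [AG [obG bGA bGP]]]] :=
  orthonormalization (fun ie : 'I_N * 'I_n => K ie.1 ie.2).
have bP' i e := bP (i, e).
have bHP' i e := bHP (i, e).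
have bGP' i e := bGP (i, e).
have [q [a [c [q0 qmin]]]] := reduced_minimizer xdot u
  (fun i e k => hdot (phi (x i) (delta_mx e 0)) (b k))
  (fun i e k => hdot (D i e) (bH k)) (fun i e k => hdot (K i e) (bG k))
  halpha hbeta hgamma.
pose Am i : 'M[R]_(r, n) := \matrix_(k, e) A k (i, e).
have bAm k : b k = \sum_i \sum_e Am i k e *: phi (x i) (delta_mx e 0).
  rewrite bA pair_bigA; apply: eq_bigr => -[i e] _.
  by rewrite mxE.
pose M i j : 'M[R]_n := (Am i)^T *m q *m Am j.
have QE := sandwich_matrix_op lphi q bAm.
exists M, (fun i => \col_e \sum_k a k * AH k (i, e)),
  (fun i => \col_e \sum_k c k * AG k (i, e)), (matrix_op b q),
  (\sum_k a k *: bH k), (\sum_k c k *: bG k); split.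
- split.
    by split; [exact: hilbert_schmidt_matrix_op | exact: nonneg_matrix_op].
  move=> Q' H' G' [hsQ' Q'0].
  apply: (le_trans (objective_matrix_op_le xdot u beta gamma DP KP bP' bHP' bGP'
    q a c hW ob obH obG halpha)).
  apply: le_trans (reduced_objective_le xdot u DP KP bP' bHP' bGP' H' G' hW ob
    obH obG halpha hbeta hgamma hsQ').
  have := qmin _ (fun k => hdot H' (bH k)) (fun k => hdot G' (bG k))
    (nonneg_compression (b := b) hsQ'.1.1 Q'0).
  congr (_ <= reduced_objective _ _ _ _ _ _ _ _ _ _ _).
  by apply/funext => k; apply/funext => l; rewrite mxE.
- exact: QE.
- apply/funext => y; rewrite evHK hdot_suml.
  transitivity (\sum_k \sum_i \sum_e a k * AH k (i, e) * grad2 h y (x i) e 0).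
    apply: eq_bigr => k _; rewrite hdotZl bHA hdot_suml mulr_sumr pair_bigA.
    apply: eq_bigr => -[i e] _; rewrite hdotZl mulrA; congr (_ * _).
    rewrite hdotC mxE.
    have -> : h y = (fun z => hdot (KH y) (KH z)) by apply/funext => z.
    by apply/esym/derive_hdot; exact: dKH.
  rewrite exchange_big; apply: eq_bigr => i _; rewrite exchange_big.
  by apply: eq_bigr => e _; rewrite [X in _ = _ * X]mxE mulr_sumr;
    apply: eq_bigr => k _; rewrite mulrC.
- apply/funext => y; apply/colP => f; rewrite evGK hdot_suml summxE.
  transitivity (\sum_k \sum_i \sum_e c k * AG k (i, e) * g y (x i) f e).
    apply: eq_bigr => k _; rewrite hdotZl bGA hdot_suml mulr_sumr pair_bigA.
    apply: eq_bigr => -[i e] _; rewrite hdotZl mulrA; congr (_ * _).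
    by rewrite -evGK KGE -colE mxE.
  rewrite exchange_big; apply: eq_bigr => i _; rewrite exchange_big mxE.
  by apply: eq_bigr => e _; rewrite [X in _ = _ * X]mxE mulr_sumr;
    apply: eq_bigr => k _; rewrite mulrC.
- split; last by rewrite QE; exact: compress_sandwich.
  have -> : (\mxblock_(i < N, j < N) M i j) =
      (\mxrow_(i < N) Am i)^T *m q *m (\mxrow_(j < N) Am j).
    rewrite -mulmxA tr_mxrow mul_mxrow mul_mxcol_mxrow.
    by apply: eq_mxblock => i j; rewrite /M mulmxA.
  exact: nonneg_mx_congr.
Qed.
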